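(* Let $n$ be a positive integer, $k\in\{1,\dots,n\}$, and let $A,B\colon[0,1]^n\to[0,1]$ be standardized functions with $A\le B$. Suppose that at least one of the functions $A$ and $B$ satisfies Condition S with set $S$. Let $\mathcal D\subseteq[0,1]^n$ be a dense countably infinite mesh with $S^n\subseteq\mathcal D$, and let $C\colon\mathcal D\to[0,1]$ be a $k$-increasing function such that $A(\mathbf d)\le C(\mathbf d)\le B(\mathbf d)$ for all $\mathbf d\in\mathcal D$. Then $C$ can be extended to a $k$-increasing function $\widehat C\colon[0,1]^n\to[0,1]$ such that $A(\mathbf x)\le\widehat C(\mathbf x)\le B(\mathbf x)$ for all $\mathbf x\in[0,1]^n$.
   Context: Write $\mathbb I=[0,1]$; $\le$ between functions is the pointwise order, and ''increasing'' means non-decreasing. Mesh. A dense countably infinite mesh in $\mathbb I^n$ is a set $\mathcal D=\prod_{i=1}^n\delta_i$ where each $\delta_i\subseteq\mathbb I$ is countably infinite, dense in $\mathbb I$, and contains both $0$ and $1$. Boxes. For $\mathbf x,\mathbf y\in\mathbb I^n$, the product $R=[\mathbf x,\mathbf y]=\prod_{i=1}^n[x_i,y_i]$ is a $k$-box if $x_i<y_i$ for exactly $k$ indices $i$ and $x_i=y_i$ for the remaining $n-k$ indices. Its vertices are $\operatorname{ver}R=\prod_{i=1}^n\{x_i,y_i\}$. The sign of a vertex $\mathbf v$ is $\operatorname{sign}_R(\mathbf v)=(-1)^{m-(n-k)}$, where $m=|\{i: v_i=x_i\}|$. Functions. A function $f$ on $\mathbb I^n$ (resp. on $\mathcal D$)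 with values in $\mathbb I$ is $k$-increasing if $\sum_{\mathbf v\in\operatorname{ver}R}\operatorname{sign}_R(\mathbf v)f(\mathbf v)\ge0$ for every $k$-box $R$ with vertices in $\mathbb I^n$ (resp. in $\mathcal D$); $1$-increasing means increasing in each variable. $f\colon\mathbb I^n\to\mathbb I$ is grounded if $f(\mathbf x)=0$ whenever some $x_i=0$; standardized if it is grounded, $1$-increasing and $f(1,\dots,1)=1$. Condition S. $f\colon\mathbb I^n\to\mathbb I$ satisfies Condition S with set $S$ if $S\subseteq\mathbb I$ is countable and for every $\mathbf u\in\mathbb I^n$ and every $i\in\{1,\dots,n\}$ the set of discontinuities of the section $t\mapsto f(u_1,\dots,u_{i-1},t,u_{i+1},\dots,u_n)$ is contained in $S$. *)

(* Defs.v *)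
From HB Require Import structures.
From mathcomp Require Import all_boot all_order all_algebra.
From mathcomp Require Import all_classical all_reals all_analysis.

Set Implicit Arguments.
Unset Strict Implicit.
Unset Printing Implicit Defensive.

Import Order.TTheory GRing.Theory Num.Theory.
Import numFieldNormedType.Exports.

Local Open Scope classical_set_scope.
Local Open Scope ring_scope.

(* A function on a subset E of the cube is a total function on 'rV[R]_n of
   which only the values on E matter; [set_fun E unit_itv f] says that it takes
   values in the unit interval there. *)

Definition unit_itv {R : realType} : set R := `[0, 1].

Definition set_prod {R : realType} {n : nat} (d : 'I_n -> set R) :
    set 'rV[R]_n :=
  [set v | forall i, d i (v ord0 i)].

Definition cube {R : realType} {n : nat} : set 'rV[R]_n :=
  set_prod (fun=> unit_itv).

Definition le_on {R : realType} {n : nat} (E : set 'rV[R]_n)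
    (f g : 'rV[R]_n -> R) : Prop :=
  forall x, E x -> f x <= g x.

Definition dense_mesh {R : realType} {n : nat} (D : set 'rV[R]_n) : Prop :=
  exists2 d : 'I_n -> set R,
    forall i, [/\ d i `<=` unit_itv,
                  (d i #= [set: nat])%card,
                  unit_itv `<=` closure (d i),
                  d i 0 & d i 1]
    & D = set_prod d.

Definition is_box {R : realType} {n : nat} (k : nat) (x y : 'rV[R]_n) : Prop :=
  [/\ cube x, cube y,
      forall i, x ord0 i <= y ord0 i
    & #|[set i | x ord0 i < y ord0 i]%SET| = k].

Definition ver {R : realType} {n : nat} (x y : 'rV[R]_n) : set 'rV[R]_n :=
  [set v | forall i, v ord0 i = x ord0 i \/ v ord0 i = y ord0 i].

(* The truncated subtraction is harmless: a vertex of a k-box agrees with x on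
   the n - k degenerate coordinates. *)
Definition vsign {R : realType} {n : nat} (k : nat) (x v : 'rV[R]_n) : R :=
  (-1) ^+ (#|[set i | v ord0 i == x ord0 i]%SET| - (n - k))%N.

Definition increasing_on {R : realType} {n : nat} (k : nat)
    (E : set 'rV[R]_n) (f : 'rV[R]_n -> R) : Prop :=
  forall x y, is_box k x y -> ver x y `<=` E ->
    0 <= \sum_(v \in ver x y) vsign k x v * f v.

Definition grounded {R : realType} {n : nat} (f : 'rV[R]_n -> R) : Prop :=
  forall x, cube x -> (exists i, x ord0 i = 0) -> f x = 0.

Definition standardized {R : realType} {n : nat} (f : 'rV[R]_n -> R) : Prop :=
  [/\ set_fun cube unit_itv f, grounded f, increasing_on 1 cube f
    & f (const_mx 1) = 1].

Definition section_of {R : realType} {n : nat} (f : 'rV[R]_n -> R)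
    (u : 'rV[R]_n) (i : 'I_n) (t : R) : R :=
  f (\row_j (if j == i then t else u ord0 j)).

(* Continuity is relative to the unit interval, hence one-sided at 0 and 1. *)
Definition discontinuities {R : realType} (g : R -> R) : set R :=
  [set t | unit_itv t /\ ~ (g @ within unit_itv (nbhs t) --> g t)].

Definition conditionS {R : realType} {n : nat} (f : 'rV[R]_n -> R)
    (S : set R) : Prop :=
  [/\ S `<=` unit_itv, countable S
    & forall u, cube u -> forall i,
        discontinuities (section_of f u i) `<=` S].

(* Main.v *)
Require Import Defs.
From HB Require Import structures.
From mathcomp Require Import all_boot all_order all_algebra.
From mathcomp Require Import all_classical all_reals all_analysis.
From mathcomp Require Import lra zify.

Set Implicit Arguments.
Unset Strict Implicit.
Unset Printing Implicit Defensive.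

Import Order.TTheory GRing.Theory Num.Theory.
Import numFieldNormedType.Exports.

Local Open Scope classical_set_scope.
Local Open Scope ring_scope.

(* If A satisfies Condition S, approximate every x in the cube by mesh points
   increasing to x, one coordinate approximation p_i for each axis, eventually
   exact at the points of delta_i; if B does, approximate from above. The
   extension of C is the limit of its values along these approximations. Boxes
   are eventually mapped to boxes with vertices in the mesh, so k-increasingness
   passes to the limit. The limit exists because C, being grounded and
   k-increasing, is increasing in each variable. Approximating from below, the
   bound by B is immediate, and the bound by A follows because A is continuous in
   each variable at the coordinates that have to be moved: these lie outside
   delta_i, hence outside S. *)

(** * Approximation of points of the unit interval within a countable dense subset *)

Lemma closure_between (R : realType) (d : set R) (s t : R) :
  unit_itv `<=` closure d -> unit_itv s -> unit_itv t -> s < t ->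
  exists2 e, d e & s < e < t.
Proof.
rewrite /unit_itv /= !in_itv/= => dense_d /andP[s0 s1] /andP[t0 t1] st.
have /dense_d cl : unit_itv ((s + t) / 2).
  by rewrite /unit_itv /= in_itv/=; lra.
have [|e [de]] := cl [set` `]s, t[].
  by apply: open_nbhs_nbhs; split; [exact: interval_open|rewrite /= in_itv/=; lra].
by rewrite /= in_itv/= => se; exists e.
Qed.

(** Eventual exactness on [d] will make the limit an extension and hold fixed the coordinates where
    a section may jump; eventual strictness keeps the nondegenerate sides of a box nondegenerate. *)
Definition mesh_approx (R : realType) (d : set R) (p : nat -> R -> R) : Prop :=
  [/\ forall m t, unit_itv t -> d (p m t),
      forall t, d t -> \forall m \near \oo, p m t = t,
      forall s t, unit_itv s -> unit_itv t -> s < t ->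
        \forall m \near \oo, p m s < p m t
    & forall t, unit_itv t -> p ^~ t @ \oo --> t].

(** Enumerate [d] as [e] and let [p m t] be the largest of 0 and those of the first [m] points that
    do not exceed [t]. A point [a <= t] of [d] bounds [p m t] from below as soon as [m] exceeds its
    index; exactness, strictness and convergence all follow from this. *)
Lemma mesh_approx_below (R : realType) (d : set R) :
  d `<=` unit_itv -> (d #= [set: nat])%card ->
  (forall s t, unit_itv s -> unit_itv t -> s < t -> exists2 e, d e & s < e < t) ->
  d 0 ->
  exists2 p, mesh_approx d p
    & forall t, unit_itv t -> nondecreasing_seq (p ^~ t) /\ forall m, p m t <= t.
Proof.
move=> d01 dN dense_d d0.
have /card_set_bijP[e [de _ e_surj]] : ([set: nat] #= d)%card by exact: card_esym.
pose p m t := \big[Order.max/0]_(i < m | e i <= t) e i.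
have p_le t m : unit_itv t -> p m t <= t.
  by rewrite /unit_itv/= in_itv/= => /andP[t0 _]; exact: bigmax_le.
have p_nd t : nondecreasing_seq (p ^~ t).
  move=> m m' mm'; apply: bigmax_le => [|i ei]; first exact: bigmax_ge_id.
  by apply: (bigmax_sup (widen_ord mm' i)).
have p_ge a t : d a -> a <= t -> \forall m \near \oo, a <= p m t.
  move=> /e_surj[j _ <-] ejt; near=> m.
  have jm : (j < m)%N by near: m; exact: nbhs_infty_gt.
  exact: (bigmax_sup (Ordinal jm)).
exists p; last by move=> t It; split=> [|m]; [exact: p_nd|exact: p_le].
split.
- move=> m t _; apply: (@big_ind _ d) => // [a b da db|i _]; last exact: de.
  by rewrite maxEle; case: ifP.
- move=> t dt; near=> m; apply/eqP; rewrite eq_le (p_le _ _ (d01 _ dt))/=.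
  by near: m; exact: p_ge.
- move=> s t Is It st; have [a da /andP[sa at_]] := dense_d _ _ Is It st.
  near=> m; apply: le_lt_trans (p_le _ _ Is) (lt_le_trans sa _).
  by near: m; apply: p_ge => //; exact: ltW.
- move=> t It; apply/cvgrPdist_lt => eps eps0.
  have [a da /andP[a1 a2]] : exists2 a, d a & t - eps < a <= t.
    move: (It); rewrite /unit_itv/= in_itv/= => /andP[t0 t1].
    (* At [t = 0] the point 0 of [d] serves. Otherwise [t - eps] is clipped at 0, since density is
       only available inside the unit interval. *)
    have [tpos|] := ltP 0 t; last by exists 0 => //; lra.
    have [||a da aa] := dense_d (Order.max 0 (t - eps)) t _ It.
    - by rewrite /unit_itv/= in_itv/= le_max lexx/= ge_max; lra.
    - by rewrite gt_max; lra.
    - by move: aa; rewrite gt_max => ?; exists a => //; lra.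
  near=> m; have pt := p_le t m It.
  have ap : a <= p m t by near: m; exact: p_ge.
  by rewrite ger0_norm; lra.
Unshelve. all: by end_near. Qed.

(** The reflection [t |-> 1 - t] turns approximation from below in the reflected set into
    approximation from above in [d]; the endpoint 1 of [d] becomes the 0 required there. *)
Lemma mesh_approx_above (R : realType) (d : set R) :
  d `<=` unit_itv -> (d #= [set: nat])%card ->
  (forall s t, unit_itv s -> unit_itv t -> s < t -> exists2 e, d e & s < e < t) ->
  d 1 ->
  exists2 p, mesh_approx d p
    & forall t, unit_itv t -> nonincreasing_seq (p ^~ t) /\ forall m, t <= p m t.
Proof.
move=> d01 dN dense_d d1; pose r (t : R) := 1 - t.
have rK : involutive r by move=> t; rewrite /r opprB addrC subrK.
have r01 t : unit_itv t -> unit_itv (r t).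
  by rewrite /unit_itv/= !in_itv/= /r => ?; lra.
have [||||p [p_in p_id p_lt p_cvg] p_mono] := @mesh_approx_below _ (r @` d).
- by move=> _ [t /d01/r01 ? <-].
- by rewrite (card_eq_trans (inj_card_eq _) dN)// => ? ? _ _; exact: can_inj rK _ _.
- move=> s t Is It st.
  have [|e de e_st] := dense_d (r t) (r s) (r01 _ It) (r01 _ Is).
    by rewrite /r; lra.
  by exists (r e); [exists e|move: e_st; rewrite /r; lra].
- by exists 1; rewrite // /r subrr.
exists (fun m t => r (p m (r t))); last first.
  move=> t /r01 It; have [nd p_le] := p_mono _ It; split=> [m m' mm'|m].
    by have := nd _ _ mm'; rewrite /r; lra.
  by have := p_le m; rewrite /r; lra.
split.
- by move=> m t /r01/p_in-/(_ m)[s ds <-]; rewrite rK.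
- move=> t dt; have := p_id (r t); move=> /(_ (ex_intro2 _ _ t dt erefl)).
  by apply: filterS => m ->; rewrite rK.
- move=> s t /r01 Is /r01 It st.
  have : r t < r s by rewrite /r; lra.
  by move=> /(p_lt _ _ It Is); apply: filterS => m; rewrite /r; lra.
- move=> t It; rewrite -[X in _ --> X]rK; apply: cvgB; first exact: cvg_cst.
  exact/p_cvg/r01.
Qed.

(** * Passing from one vector to another, one coordinate at a time *)

Definition hybrid (R : realType) (n j : nat) (x y : 'rV[R]_n) : 'rV[R]_n :=
  \row_i (if (i < j)%N then y ord0 i else x ord0 i).

Lemma hybrid0 (R : realType) (n : nat) (x y : 'rV[R]_n) : hybrid 0 x y = x.
Proof. by apply/rowP => i; rewrite mxE. Qed.

Lemma hybrid_full (R : realType) (n : nat) (x y : 'rV[R]_n) : hybrid n x y = y.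
Proof. by apply/rowP => i; rewrite mxE ltn_ord. Qed.

Lemma section_hybridS (R : realType) (n : nat) (f : 'rV[R]_n -> R) (i : 'I_n)
    (x y : 'rV[R]_n) :
  section_of f (hybrid i x y) i (y ord0 i) = f (hybrid i.+1 x y).
Proof.
congr f; apply/rowP => j; rewrite !mxE ltnS [in RHS]leq_eqVlt.
by case: eqVneq => [->|ji]; rewrite ?eqxx// val_eqE (negPf ji).
Qed.

Lemma section_id (R : realType) (n : nat) (f : 'rV[R]_n -> R) (i : 'I_n)
    (u : 'rV[R]_n) : section_of f u i (u ord0 i) = f u.
Proof. by congr f; apply/rowP => j; rewrite mxE; case: eqP => [->|]. Qed.

Lemma set_prod_hybrid (R : realType) (n j : nat) (d : 'I_n -> set R)
    (x y : 'rV[R]_n) :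
  set_prod d x -> set_prod d y -> set_prod d (hybrid j x y).
Proof. by move=> dx dy i; rewrite mxE; case: ifP. Qed.

(** * Monotonicity of grounded k-increasing functions *)

Lemma exists_set_card (T : finType) (A : {set T}) (k : nat) : (k <= #|A|)%N ->
  exists2 B : {set T}, B \subset A & #|B| = k.
Proof.
move=> kA; exists [set x in take k (enum A)].
  by apply/fintype.subsetP => x; rewrite inE => /mem_take; rewrite mem_enum.
by rewrite cardsE (card_uniqP _) ?take_uniq ?enum_uniq// size_takel -?cardE.
Qed.

(* The segment is enlarged to a k-box by stretching k - 1 further coordinates
   down to 0; the vertices added lie in the zero set of f. *)
Lemma grounded_section_le (R : realType) (n k : nat) (d : 'I_n -> set R)
    (f : 'rV[R]_n -> R) (i : 'I_n) (u : 'rV[R]_n) (t : R) :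
  (1 <= k <= n)%N -> (forall i, d i `<=` unit_itv) -> (forall i, d i 0) ->
  (forall x, set_prod d x -> (exists i, x ord0 i = 0) -> f x = 0) ->
  increasing_on k (set_prod d) f ->
  set_prod d u -> d i t -> u ord0 i <= t -> f u <= section_of f u i t.
Proof.
move=> /andP[k0 kn] d01 d0 f0 f_incr du dt.
rewrite le_eqVlt => /predU1P[<-|ut]; first by rewrite section_id.
set y := \row_j (if j == i then t else u ord0 j).
have dy : set_prod d y by move=> j; rewrite mxE; case: eqP => [->|].
rewrite -[section_of _ _ _ _]/(f y).
(* If [u] vanishes at a coordinate other than [i], so does [y], and both values are 0. Otherwise
   those coordinates are positive, so stretching one down to 0 gives a nondegenerate side. *)
have [[j ji uj]|u_neq0] := pselect (exists2 j, j != i & u ord0 j = 0).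
  by rewrite (f0 u) ?f0//; exists j; rewrite // mxE (negPf ji).
have u_gt0 j : j != i -> 0 < u ord0 j.
  move=> ji; rewrite lt_neqAle eq_sym; apply/andP; split.
    by apply/eqP => uj; apply: u_neq0; exists j.
  by have /d01 := du j; rewrite /unit_itv/= in_itv/= => /andP[].
(* [T] collects the k - 1 coordinates to be stretched, out of the n - 1 different from [i]. *)
have [|T Ti cT] := @exists_set_card _ [set~ i]%SET k.-1.
  by rewrite cardsC1 card_ord -!subn1 leq_sub2r.
have {}Ti j : j \in T -> j != i by move=> /(fintype.subsetP Ti); rewrite !inE.
have iT : i \notin T by apply/negP => /Ti; rewrite eqxx.
pose x : 'rV[R]_n := \row_j (if j \in T then 0 else u ord0 j).
have dx : set_prod d x by move=> j; rewrite mxE; case: ifP.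
have xy_lt j : (x ord0 j < y ord0 j) = (j \in i |: T)%SET.
  rewrite !mxE !inE; case: eqVneq => [->|ji] /=; first by rewrite (negPf iT).
  by case: ifP => _; [exact: u_gt0|rewrite ltxx].
have xy_le j : x ord0 j <= y ord0 j.
  have [jT|jT] := boolP (j \in i |: T)%SET; first by rewrite ltW// xy_lt.
  by move: jT; rewrite !mxE !inE negb_or => /andP[/negPf-> /negPf->].
have box_xy : is_box k x y.
  split=> //; [by move=> j; apply: d01|by move=> j; apply: d01|].
  rewrite (_ : [set _ | _]%SET = i |: T)%SET; last first.
    by apply/setP => j; rewrite inE xy_lt.
  by rewrite cardsU1 iT cT add1n prednK.
have ver_d : ver x y `<=` set_prod d by move=> v xyv j; case: (xyv j) => ->.
have ver_u : ver x y u.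
  by move=> j; rewrite !mxE; case: ifP => [/Ti/negPf->|_]; [right|left].
have ver_y : ver x y y by move=> j; right.
have uNy : u != y.
  by apply/eqP => /rowP/(_ i); rewrite mxE eqxx => uit; rewrite uit ltxx in ut.
have := f_incr x y box_xy ver_d.
(* Only [u] and [y] contribute: a vertex without a zero coordinate in [T] agrees with [u] off [i],
   and its coordinate [i] is that of [u] or that of [y]. *)
rewrite (fsbigE [:: u; y])/=; last 3 first.
- by rewrite inE uNy.
- by move=> v; rewrite /= !inE => /orP[]/eqP->.
- move=> v xyv; rewrite !inE negb_or => /andP[vu vy].
  suff [j jT vj] : exists2 j, j \in T & v ord0 j = 0.
    by rewrite f0 ?mulr0//; [exact: ver_d|exists j].
  apply: contrapT => v_neq0.
  have vE j : j != i -> v ord0 j = u ord0 j.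
    move=> ji; have := xyv j; rewrite !mxE (negPf ji).
    by case: ifP => jT [] // vj; exfalso; apply: v_neq0; exists j.
  have := xyv i; rewrite !mxE eqxx (negPf iT) => -[] vi.
    move/eqP: vu; apply; apply/rowP => j.
    by have [->//|/vE] := eqVneq j i.
  move/eqP: vy; apply; apply/rowP => j; rewrite mxE.
  by case: eqVneq => [->//|/vE].
rewrite !big_cons big_nil !mem_set// addr0.
(* [u] agrees with [x] exactly off [T], in n - (k - 1) coordinates, so the exponent is 1; [y] agrees
   with [x] in n - k coordinates, so its exponent is 0. *)
have -> : vsign k x u = -1.
  rewrite /vsign (_ : [set _ | _]%SET = ~: T)%SET.
    rewrite cardsCs finset.setCK card_ord cT (_ : (n - k.-1 - (n - k) = 1)%N) ?expr1//; lia.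
  apply/setP => j; rewrite !inE mxE; case: ifP => [/Ti/u_gt0 uj|]; last by rewrite eqxx.
  by rewrite gt_eqF.
have -> : vsign k x y = 1.
  rewrite /vsign (_ : [set _ | _]%SET = ~: (i |: T))%SET.
    by rewrite cardsCs finset.setCK card_ord cardsU1 iT cT add1n prednK// subnn.
  by apply/setP => j; rewrite finset.in_setC -xy_lt [in RHS]lt_neqAle xy_le andbT negbK inE eq_sym.
by rewrite mulN1r mul1r; lra.
Qed.

(** Walk from [x] to [y] through the points [hybrid j x y]: each step raises a single coordinate and
    stays in the product set. *)
Lemma grounded_increasing_le (R : realType) (n k : nat) (d : 'I_n -> set R)
    (f : 'rV[R]_n -> R) (x y : 'rV[R]_n) :
  (1 <= k <= n)%N -> (forall i, d i `<=` unit_itv) -> (forall i, d i 0) ->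
  (forall x, set_prod d x -> (exists i, x ord0 i = 0) -> f x = 0) ->
  increasing_on k (set_prod d) f ->
  set_prod d x -> set_prod d y -> (forall i, x ord0 i <= y ord0 i) -> f x <= f y.
Proof.
move=> kn d01 d0 f0 f_incr dx dy xy.
suff H j : (j <= n)%N -> f x <= f (hybrid j x y).
  by have := H n (leqnn n); rewrite hybrid_full.
elim: j => [|j IH] jn; first by rewrite hybrid0.
apply: (le_trans (IH (ltnW jn))); rewrite -(section_hybridS f (Ordinal jn)).
apply: (grounded_section_le kn) => //; first exact: set_prod_hybrid.
by rewrite mxE /= ltnn.
Qed.

(** * Box sums and their limits under coordinatewise approximation *)

Definition coordwise (R : realType) (n : nat) (q : 'I_n -> R -> R)
    (x : 'rV[R]_n) : 'rV[R]_n :=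
  \row_i q i (x ord0 i).

Lemma finite_ver (R : realType) (n : nat) (x y : 'rV[R]_n) : finite_set (ver x y).
Proof.
pose h (T : {set 'I_n}) : 'rV[R]_n := \row_i (if i \in T then x ord0 i else y ord0 i).
apply: (@sub_finite_set _ _ (h @` setT)); last exact: finite_image.
move=> v xyv; exists [set i | v ord0 i == x ord0 i]%SET => //.
apply/rowP => i; rewrite mxE inE; case: eqP => [->//|vx].
by case: (xyv i).
Qed.

(** Since [q] never merges distinct end coordinates, each coordinate of an image vertex reveals the
    end it came from. *)
Lemma ver_coordwise_bij (R : realType) (n : nat) (q : 'I_n -> R -> R)
    (x y : 'rV[R]_n) :
  (forall i, q i (x ord0 i) = q i (y ord0 i) -> x ord0 i = y ord0 i) ->
  set_bij (ver x y) (ver (coordwise q x) (coordwise q y)) (coordwise q).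
Proof.
move=> q_inj; split.
- by move=> v xyv i; rewrite !mxE; case: (xyv i) => ->; [left|right].
- move=> v w; rewrite !inE => xyv xyw /rowP vw; apply/rowP => i.
  have := vw i; rewrite !mxE.
  by case: (xyv i) (xyw i) => -> [] -> // => [|/esym] /q_inj.
- move=> w xyw; exists (\row_i if w ord0 i == q i (x ord0 i) then x ord0 i else y ord0 i).
    by move=> i; rewrite mxE; case: ifP; [left|right].
  apply/rowP => i; rewrite !mxE; case: eqP => [//|wx].
  by have := xyw i; rewrite !mxE => -[].
Qed.

(** A vertex agrees with [x] in the same coordinates in which its image agrees with the image of
    [x], so the two carry the same sign. *)
Lemma sum_ver_coordwise (R : realType) (n k : nat) (q : 'I_n -> R -> R)
    (f : 'rV[R]_n -> R) (x y : 'rV[R]_n) :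
  (forall i, q i (x ord0 i) = q i (y ord0 i) -> x ord0 i = y ord0 i) ->
  \sum_(v \in ver (coordwise q x) (coordwise q y)) vsign k (coordwise q x) v * f v =
  \sum_(v \in ver x y) vsign k x v * f (coordwise q v).
Proof.
move=> q_inj; rewrite (reindex_fsbig (coordwise q) (ver x y)); last first.
  exact: ver_coordwise_bij.
apply: eq_fsbigr => v; rewrite inE => xyv; congr (_ * _).
rewrite /vsign; congr ((-1) ^+ (_ - _)); apply: eq_card => i.
rewrite !inE !mxE; apply/eqP/eqP => [|->//].
by case: (xyv i) => -> // /esym/q_inj.
Qed.

(** The box sum of [g] is the limit of the box sums of [f] over the image boxes, which for large [m]
    are k-boxes with vertices in the mesh. *)
Lemma increasing_on_limit (R : realType) (n k : nat) (d : 'I_n -> set R)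
    (p : 'I_n -> nat -> R -> R) (f g : 'rV[R]_n -> R) :
  (forall i, d i `<=` unit_itv) -> (forall i, mesh_approx (d i) (p i)) ->
  increasing_on k (set_prod d) f ->
  (forall x, cube x -> f (coordwise (fun i => p i m) x) @[m --> \oo] --> g x) ->
  increasing_on k cube g.
Proof.
move=> d01 p_approx f_incr fg x y [Ix Iy xy_le xy_card] ver_xy.
have lt_near : \forall m \near \oo, forall i, x ord0 i < y ord0 i ->
    p i m (x ord0 i) < p i m (y ord0 i).
  apply: filter_forall => i.
  have [xy|] := ltP (x ord0 i) (y ord0 i).
    have [_ _ p_lt _] := p_approx i.
    by have := p_lt _ _ (Ix i) (Iy i) xy; apply: filterS => m.
  by move=> _; apply: nearW.
have sum_cvg : (\sum_(v \in ver x y) vsign k x v * f (coordwise (fun i => p i m) v))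
    @[m --> \oo] --> \sum_(v \in ver x y) vsign k x v * g v.
  have [s sE] := (finite_seqP _).1 (finite_ver x y).
  have sumE F : \sum_(v \in ver x y) F v = \sum_(v <- undup s | v \in s) F v :> R.
    have -> : ver x y = [set` undup s].
      by rewrite sE; apply/seteqP; split=> v; rewrite /= mem_undup.
    rewrite -fsbig_seq ?undup_uniq// big_seq.
    by apply: eq_bigl => v; rewrite mem_undup.
  rewrite sumE; under eq_fun do rewrite sumE.
  apply: cvg_big => [|v sv]; first exact: add_continuous.
  by apply: cvgMr; apply/fg/ver_xy; rewrite sE.
apply: (cvgr_to_ge sum_cvg); near=> m.
have m_lt : forall i, x ord0 i < y ord0 i -> p i m (x ord0 i) < p i m (y ord0 i).
  by near: m.
have px_in z : cube z -> set_prod d (coordwise (fun i => p i m) z).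
  by move=> Iz i; rewrite mxE; have [+ _ _ _] := p_approx i; apply; exact: Iz.
have m_inj i : p i m (x ord0 i) = p i m (y ord0 i) -> x ord0 i = y ord0 i.
  move=> pxy; apply/eqP; rewrite eq_le xy_le /= leNgt; apply/negP => /m_lt.
  by rewrite pxy ltxx.
rewrite -(@sum_ver_coordwise _ _ k (fun i => p i m) f x y m_inj).
apply: f_incr; last first.
  by move=> v xyv i; case: (xyv i) => ->; exact: px_in.
split.
- by move=> i; apply: (d01 i); exact: px_in.
- by move=> i; apply: (d01 i); exact: px_in.
- move=> i; rewrite !mxE; have := xy_le i; rewrite le_eqVlt => /predU1P[->//|].
  by move=> /m_lt/ltW.
- rewrite -xy_card; apply: eq_card => i; rewrite !inE !mxE.
  apply/idP/idP => [|/m_lt//]; apply: contraLR; rewrite -!leNgt => yx.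
  by rewrite (_ : x ord0 i = y ord0 i)//; apply/eqP; rewrite eq_le xy_le.
Unshelve. all: by end_near. Qed.

(** * Convergence along the approximations under Condition S *)

(* Separate continuity only allows the coordinates to be moved one after the
   other, hence an index M i for each of them; monotonicity provides a common
   index in [conditionS_cvg]. *)
Lemma conditionS_approx (R : realType) (n : nat) (F : 'rV[R]_n -> R) (S : set R)
    (x : 'rV[R]_n) (c : 'I_n -> nat -> R) (eps : R) :
  conditionS F S -> cube x -> (forall i m, unit_itv (c i m)) ->
  (forall i, c i @ \oo --> x ord0 i) ->
  (forall i, S (x ord0 i) -> \forall m \near \oo, c i m = x ord0 i) ->
  0 < eps -> exists M : 'I_n -> nat, `|F (\row_i c i (M i)) - F x| < eps.
Proof.
move=> [_ _ F_disc] Ix Ic c_cvg c_S.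
suff H j : (j <= n)%N -> forall eps : R, 0 < eps ->
    exists M : 'I_n -> nat, `|F (hybrid j x (\row_i c i (M i))) - F x| < eps.
  by move=> /(H n (leqnn n))[M]; rewrite hybrid_full; exists M.
elim: j => [|j IH] jn {}eps eps0.
  by exists (fun=> 0%N); rewrite hybrid0 subrr normr0.
have [|M FM] := IH (ltnW jn) (eps / 2); first by rewrite divr_gt0.
pose j' := Ordinal jn; pose u := hybrid j x (\row_i c i (M i)).
have uj : u ord0 j' = x ord0 j' by rewrite mxE ltnn.
have Iu : cube u.
  by apply: set_prod_hybrid => [|i]; [exact: Ix|rewrite mxE; exact: Ic].
have g_cvg : section_of F u j' (c j' m) @[m --> \oo] --> section_of F u j' (x ord0 j').
  (* At a point of [S] the sequence is eventually constant; elsewhere the section is continuous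
     relative to the unit interval, which the sequence never leaves. *)
  have [Sx|nSx] := pselect (S (x ord0 j')).
    by apply: cvg_near_cst; apply: filterS (c_S j' Sx) => m ->.
  have [cont|ncont] := pselect (section_of F u j' @ within unit_itv (nbhs (x ord0 j'))
      --> section_of F u j' (x ord0 j')).
    apply: (@cvg_comp _ _ _ (c j') (section_of F u j') _ _ _ _ cont) => P /= xP.
    have : \forall m \near \oo, unit_itv (c j' m) -> P (c j' m) := c_cvg _ _ xP.
    by apply: (@filterS _ \oo) => m; apply; exact: Ic.
  by exfalso; apply: nSx; apply: (F_disc u Iu j'); split.
have [m Fm] : exists m, `|section_of F u j' (c j' m) - F u| < eps / 2.
  have e2 : 0 < eps / 2 by rewrite divr_gt0.
  have /cvgrPdistC_lt/(_ _ e2) := g_cvg; rewrite -uj section_id => -[N _ HN].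
  by exists N; exact: (HN N (leqnn N)).
exists (fun i => if i == j' then m else M i).
rewrite -(section_hybridS F j').
(* Resetting the index of coordinate [j'] leaves [u] unchanged, as [u] takes only earlier
   coordinates from the approximation. *)
have -> : hybrid j' x (\row_i c i (if i == j' then m else M i)) = u.
  apply/rowP => i; rewrite !mxE; case: ifP => // ij.
  by case: eqP ij => // ->; rewrite ltnn.
rewrite mxE eqxx [eps]splitr.
rewrite (_ : _ - F x = (section_of F u j' (c j' m) - F u) + (F u - F x)).
  by apply: le_lt_trans (ler_normD _ _) _; exact: ltrD.
by rewrite addrA subrK.
Qed.

(** The boolean records the side of approximation, so that both cases share the statements below. *)
Definition one_sided (R : realType) (x : R) (c : nat -> R) (below : bool) : Prop :=
  if below then nondecreasing_seq c /\ forall m, c m <= x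
  else nonincreasing_seq c /\ forall m, x <= c m.

(** Once [m] exceeds every [M i], monotonicity places the value at the common index [m] between the
    value at the indices [M i] and [F x]. *)
Lemma conditionS_cvg (R : realType) (n : nat) (F : 'rV[R]_n -> R) (S : set R)
    (x : 'rV[R]_n) (c : 'I_n -> nat -> R) (below : bool) :
  (forall x y, cube x -> cube y -> (forall i, x ord0 i <= y ord0 i) -> F x <= F y) ->
  conditionS F S -> cube x -> (forall i m, unit_itv (c i m)) ->
  (forall i, c i @ \oo --> x ord0 i) ->
  (forall i, S (x ord0 i) -> \forall m \near \oo, c i m = x ord0 i) ->
  (forall i, one_sided (x ord0 i) (c i) below) ->
  F (\row_i c i m) @[m --> \oo] --> F x.
Proof.
move=> F_le FS Ix Ic c_cvg c_S c_side; apply/cvgrPdistC_lt => eps eps0.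
have [M FM] := conditionS_approx FS Ix Ic c_cvg c_S eps0.
near=> m.
have Mm : forall i, (M i <= m)%N.
  by near: m; apply: filter_forall => i; exact: nbhs_infty_ge.
apply: le_lt_trans FM.
have Icr h : cube (\row_i c i (h i)) by move=> i; rewrite mxE; exact: Ic.
case: below c_side => c_side.
- have Fx : F (\row_i c i m) <= F x.
    by apply: F_le => // i; rewrite mxE; exact: (c_side i).2.
  have FM : F (\row_i c i (M i)) <= F (\row_i c i m).
    by apply: F_le => // i; rewrite !mxE; exact: (c_side i).1.
  by rewrite !ler0_norm; lra.
- have Fx : F x <= F (\row_i c i m).
    by apply: F_le => // i; rewrite mxE; exact: (c_side i).2.
  have FM : F (\row_i c i m) <= F (\row_i c i (M i)).
    by apply: F_le => // i; rewrite !mxE; exact: (c_side i).1.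
  by rewrite !ger0_norm; lra.
Unshelve. all: by end_near. Qed.

(** * The extension and its bounds *)

(** Along a one-sided approximation the values of [C] form a bounded monotone sequence, whose limit
    defines [Chat]; at a mesh point this sequence is eventually constant. *)
Lemma increasing_extension (R : realType) (n k : nat) (d : 'I_n -> set R)
    (p : 'I_n -> nat -> R -> R) (below : bool) (C : 'rV[R]_n -> R) :
  (1 <= k <= n)%N -> (forall i, d i `<=` unit_itv) -> (forall i, d i 0) ->
  (forall i, mesh_approx (d i) (p i)) ->
  (forall i t, unit_itv t -> one_sided t (p i ^~ t) below) ->
  set_fun (set_prod d) unit_itv C ->
  (forall x, set_prod d x -> (exists i, x ord0 i = 0) -> C x = 0) ->
  increasing_on k (set_prod d) C ->
  exists Chat : 'rV[R]_n -> R,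
    [/\ set_fun cube unit_itv Chat, increasing_on k cube Chat,
        forall x, set_prod d x -> Chat x = C x
      & forall x, cube x ->
          C (coordwise (fun i => p i m) x) @[m --> \oo] --> Chat x].
Proof.
move=> kn d01 d0 p_approx p_side C01 C0 C_incr.
have px_in m z : cube z -> set_prod d (coordwise (fun i => p i m) z).
  by move=> Iz i; rewrite mxE; have [+ _ _ _] := p_approx i; apply; exact: Iz.
have C_le := grounded_increasing_le kn d01 d0 C0 C_incr.
have C01' m z : cube z -> 0 <= C (coordwise (fun i => p i m) z) <= 1.
  by move=> Iz; have /C01 := px_in m z Iz; rewrite /unit_itv/= in_itv.
pose Chat x := limn (fun m => C (coordwise (fun i => p i m) x)).
have C_cvg x : cube x -> C (coordwise (fun i => p i m) x) @[m --> \oo] --> Chat x.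
  move=> Ix; case: below p_side => p_side.
  - apply: nondecreasing_is_cvgn => [m m' mm'|].
      apply: C_le; [exact: px_in|exact: px_in|move=> i; rewrite !mxE].
      exact: (p_side i _ (Ix i)).1.
    by exists 1 => _ [m _ <-]; have /andP[] := C01' m x Ix.
  - apply: nonincreasing_is_cvgn => [m m' mm'|].
      apply: C_le; [exact: px_in|exact: px_in|move=> i; rewrite !mxE].
      exact: (p_side i _ (Ix i)).1.
    by exists 0 => _ [m _ <-]; have /andP[] := C01' m x Ix.
exists Chat; split => //.
- move=> x Ix; rewrite /unit_itv/= in_itv/=; apply/andP; split.
    by apply: (cvgr_to_ge (C_cvg x Ix)); apply: nearW => m; have /andP[] := C01' m x Ix.
  by apply: (cvgr_to_le (C_cvg x Ix)); apply: nearW => m; have /andP[] := C01' m x Ix.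
- exact: increasing_on_limit p_approx C_incr C_cvg.
- move=> x dx; apply: lim_near_cst => //.
  have : \forall m \near \oo, forall i, p i m (x ord0 i) = x ord0 i.
    by apply: filter_forall => i; have [_ p_id _ _] := p_approx i; exact: p_id.
  by apply: filterS => m pm; congr C; apply/rowP => i; rewrite mxE pm.
Qed.

Theorem proposition6p1 (R : realType) (n k : nat)
    (A B C : 'rV[R]_n -> R) (S : set R) (D : set 'rV[R]_n)
    (n_gt0 : (0 < n)%N) (k_range : (1 <= k <= n)%N)
    (stdA : standardized A) (stdB : standardized B)
    (leAB : le_on cube A B)
    (condS : conditionS A S \/ conditionS B S)
    (meshD : dense_mesh D)
    (SD : set_prod (fun=> S) `<=` D)
    (C_unit : set_fun D unit_itv C)
    (C_incr : increasing_on k D C)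
    (leAC : le_on D A C) (leCB : le_on D C B) :
  exists Chat : 'rV[R]_n -> R,
    [/\ set_fun cube unit_itv Chat,
        increasing_on k cube Chat,
        (forall d, D d -> Chat d = C d),
        le_on cube A Chat
      & le_on cube Chat B].
Proof.
have std_le (F : 'rV[R]_n -> R) : standardized F -> forall x y, cube x -> cube y ->
    (forall i, x ord0 i <= y ord0 i) -> F x <= F y.
  move=> [_ F0 F_incr _] x y Ix Iy xy.
  have I0 : unit_itv (0 : R) by rewrite /unit_itv/= in_itv/= lexx ler01.
  (* The cube is itself a product of sets containing 0, so the monotonicity result applies with k =
     1. *)
  by apply: (@grounded_increasing_le _ _ 1 (fun=> unit_itv) F x y n_gt0) => // _.
have A_le := std_le _ stdA; have B_le := std_le _ stdB.
have [d dP DE] := meshD; subst D.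
have d01 i : d i `<=` unit_itv by have [] := dP i.
have d0 i : d i 0 by have [] := dP i.
have cubeD x : set_prod d x -> cube x by move=> dx i; exact/d01/dx.
have S_d i : S `<=` d i.
  move=> s Ss; have /SD/(_ i) : set_prod (fun=> S) (const_mx s : 'rV[R]_n).
    by move=> j; rewrite mxE.
  by rewrite mxE.
have C0 x : set_prod d x -> (exists i, x ord0 i = 0) -> C x = 0.
  (* [C] is squeezed between [A] and [B], which both vanish here. *)
  move=> dx x0; have [_ A0 _ _] := stdA; have [_ B0 _ _] := stdB.
  have Ix := cubeD x dx; apply/eqP; rewrite eq_le.
  by rewrite -{1}(B0 x Ix x0) -(A0 x Ix x0) leCB ?leAC.
have [below [p [p_approx p_side p_cond]]] : exists below : bool,
    exists p : 'I_n -> nat -> R -> R,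
    [/\ forall i, mesh_approx (d i) (p i),
        forall i t, unit_itv t -> one_sided t (p i ^~ t) below
      & if below then conditionS A S else conditionS B S].
  case: condS => condS; [exists true|exists false].
  - have /choice[p pP] i : exists q, mesh_approx (d i) q /\
        forall t, unit_itv t -> one_sided t (q ^~ t) true.
      have [_ dN dd _ _] := dP i.
      have [|q] := mesh_approx_below (d01 i) dN _ (d0 i).
        by move=> s t; exact: closure_between.
      by exists q.
    by exists p; split => // i; have [] := pP i.
  - have /choice[p pP] i : exists q, mesh_approx (d i) q /\
        forall t, unit_itv t -> one_sided t (q ^~ t) false.
      have [_ dN dd _ d1] := dP i.
      have [|q] := mesh_approx_above (d01 i) dN _ d1.
        by move=> s t; exact: closure_between.
      by exists q.
    by exists p; split => // i; have [] := pP i.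
have [Chat [Chat01 Chat_incr ChatE C_cvg]] :=
  increasing_extension k_range d01 d0 p_approx p_side C_unit C0 C_incr.
have px_in m x : cube x -> set_prod d (coordwise (fun i => p i m) x).
  by move=> Ix i; rewrite mxE; have [+ _ _ _] := p_approx i; apply; exact: Ix.
have F_cvg (F : 'rV[R]_n -> R) x : standardized F -> conditionS F S -> cube x ->
    F (coordwise (fun i => p i m) x) @[m --> \oo] --> F x.
  move=> stdF FS Ix.
  apply: (conditionS_cvg (c := fun i m => p i m (x ord0 i)) (std_le _ stdF) FS Ix).
  - by move=> i m; apply: (d01 i); have [+ _ _ _] := p_approx i; apply; exact: Ix.
  - by move=> i; have [_ _ _] := p_approx i; apply; exact: Ix.
  - by move=> i Sx; have [_ + _ _] := p_approx i; apply; exact: S_d.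
  - by move=> i; apply: p_side; exact: Ix.
(* For each bound, first approximation from below, then from above. The bound by the function with
   Condition S is a limit of inequalities on the mesh; for the other bound, monotonicity suffices,
   since the approximants lie on the favourable side of [x]. *)
exists Chat; split => // x Ix; case: below p_side p_cond => p_side condF.
- apply: (ler_cvg_to (F_cvg A x stdA condF Ix) (C_cvg x Ix)).
  by apply: nearW => m; apply: leAC; exact: px_in.
- apply: (cvgr_to_ge (C_cvg x Ix)); apply: nearW => m.
  apply: (le_trans _ (leAC _ (px_in m x Ix))); apply: A_le => // [|i].
    exact/cubeD/px_in.
  by rewrite mxE; exact: (p_side i _ (Ix i)).2.
- apply: (cvgr_to_le (C_cvg x Ix)); apply: nearW => m.
  apply: (le_trans (leCB _ (px_in m x Ix))); apply: B_le => // [|i].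
    exact/cubeD/px_in.
  by rewrite mxE; exact: (p_side i _ (Ix i)).2.
- apply: (ler_cvg_to (C_cvg x Ix) (F_cvg B x stdB condF Ix)).
  by apply: nearW => m; apply: leCB; exact: px_in.
Qed.
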